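(* A locally compact group $G$ is approximable by finite semigroups if and only if it is approximable by finite groups.
   Context: Approximability: let $C\subseteq G$ be compact, $U$ a neighborhood of the unit, and $(H,\odot)$ a finite algebra (a set with one binary operation). $(H,j)$, $j:H\to G$, is a $(C,U)$-approximation of $G$ if $C\subseteq j(H)U$ and for all $x,y\in H$ with $j(x),j(y),j(x)j(y)\in C$ one has $j(x\odot y)\in j(x)j(y)U$. For a class $\mathcal K$ of finite algebras, $G$ is approximable by systems of $\mathcal K$ if for every compact $C\subseteq G$ and every neighborhood $U$ of the unit there is a $(C,U)$-approximation $(H,j)$ with $H\in\mathcal K$ and $j$ injective. *)

(* Defs.v *)
From HB Require Import structures.
From mathcomp Require Import all_boot all_order all_algebra.
From mathcomp Require Import all_classical all_reals all_analysis.
Set Implicit Arguments. Unset Strict Implicit. Unset Printing Implicit Defensive.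
Local Open Scope classical_set_scope.

Definition is_group_law (T : Type) (mul : T -> T -> T) (inv : T -> T) (e : T) :=
  [/\ associative mul, left_id e mul, right_id e mul,
      (forall x, mul (inv x) x = e) & (forall x, mul x (inv x) = e)].

Definition topological_group (T : topologicalType)
    (mul : T -> T -> T) (inv : T -> T) (e : T) :=
  [/\ is_group_law mul inv e,
      continuous (fun p : T * T => mul p.1 p.2) & continuous inv].

Definition locally_compact_group (T : topologicalType)
    (mul : T -> T -> T) (inv : T -> T) (e : T) :=
  [/\ topological_group mul inv e, hausdorff_space T & locally_compact [set: T]].

Definition alg_class := forall H : finType, (H -> H -> H) -> Prop.

Definition finite_semigroup : alg_class := fun H op => associative op.

Definition finite_group : alg_class := fun H op =>
  associative op /\
  exists u : H, [/\ left_id u op, right_id u op &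
                    forall x, exists y, op y x = u /\ op x y = u].

Definition CU_approximation (T : topologicalType) (mul : T -> T -> T)
    (C U : set T) (H : finType) (op : H -> H -> H) (j : H -> T) :=
  C `<=` [set mul (j h) u | h in [set: H] & u in U] /\
  (forall x y : H, C (j x) -> C (j y) -> C (mul (j x) (j y)) ->
     exists2 u, U u & j (op x y) = mul (mul (j x) (j y)) u).

Definition approximable_by (T : topologicalType) (mul : T -> T -> T) (e : T)
    (K : alg_class) :=
  forall C U : set T, compact C -> nbhs e U ->
    exists (H : finType) (op : H -> H -> H) (j : H -> T),
      [/\ K H op, injective j & CU_approximation mul C U op j].

(* Main.v *)
(** Let [j : H -> T] be a semigroup approximation that is accurate on a large
    compact set, and take a two-sided ideal [I] of [H] minimal among those
    meeting the preimage of a compact neighbourhood [K] of the unit. If [b] in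
    [I] has [j b] in a controlled compact set, then multiplying [b] by some [s]
    close to the unit and by an approximate inverse [t] of [s b] gives
    [j (s b t)] in [K], so [H b H = I] by minimality. Hence there is [a] in [I]
    close to the unit, and [a], [a a] and all [a x a] with [j x] under control
    generate the same ideal. By finiteness a power [i] of [a] is an idempotent
    with [i a = a = a i], and each such [a x a] is a unit of the monoid [i H i].
    The group of units of [i H i], with the restriction of [j], is the desired
    approximation: [j i] itself may be far from the unit, but only the
    elements [a x a] are needed to cover the given compact set. *)
Require Import Defs.
From HB Require Import structures.
From mathcomp Require Import all_boot all_order all_algebra.
From mathcomp Require Import all_classical all_reals all_analysis.
From mathcomp Require Import zify.

Set Implicit Arguments. Unset Strict Implicit. Unset Printing Implicit Defensive.

(** * Idempotents, units and ideals in finite semigroups *)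

Section FiniteSemigroup.
Variables (H : finType) (op : H -> H -> H).
Hypothesis opA : associative op.
Local Notation "x ** y" := (op x y) (at level 40, left associativity).

(* [spow a n] is the power of exponent n + 1, as there is no unit. *)
Let spow (a : H) n := iter n (op a) a.

Lemma spowS a n : spow a n.+1 = a ** spow a n.
Proof. by []. Qed.

Lemma spowSr a n : spow a n.+1 = spow a n ** a.
Proof. by elim: n => // n IHn; rewrite spowS {1}IHn opA. Qed.

Lemma spowD a m n : spow a m ** spow a n = spow a (m + n).+1.
Proof. by elim: m => // m IHm; rewrite spowS -opA IHm. Qed.

(** By the pigeonhole principle the powers of [a] are eventually periodic. *)
Lemma idempotent_spow a : exists n, spow a n ** spow a n = spow a n.
Proof.
have [i [d spow_id]] : exists i d, spow a (i + d.+1) = spow a i.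
  have /injectivePn[i [k nik eqik]] : ~~ injectiveb (fun i : 'I_#|H|.+1 => spow a i).
    by apply/negP => /injectiveP /leq_card; rewrite card_ord ltnn.
  wlog ltik : i k nik eqik / (i < k)%N.
    move=> W; have [/W|ltki|/val_inj eik] := ltngtP i k; first exact.
      by apply: (W k i) => //; rewrite eq_sym.
    by rewrite eik eqxx in nik.
  by exists i, (k - i.+1)%N; rewrite addnS -addSn subnKC.
have period n : (i <= n)%N -> spow a (n + d.+1) = spow a n.
  move=> lein; rewrite -(subnK lein).
  elim: (n - i)%N => [|m IHm]; first by rewrite add0n.
  by rewrite !addSn !spowS IHm.
have periods m n : (i <= n)%N -> spow a (n + m * d.+1) = spow a n.
  move=> lein; elim: m => [|m IHm]; first by rewrite mul0n addn0.
  by rewrite mulSn addnCA addnC period // (leq_trans lein) // leq_addr.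
(* The true exponent [n + 1] is a multiple of the period lying beyond the preperiod, so doubling it
   changes nothing. *)
exists (i.+1 * d.+1).-1; rewrite spowD -addnS prednK // periods //.
by rewrite -ltnS prednK // leq_pmulr.
Qed.

(** Iterating [a = u a (a v)] gives [a = w a f] for an idempotent power [f] of [a v]. Hence
    [a f = a], and [f] begins with the factor [a]. *)
Lemma split_right a u v : a = u ** (a ** a) ** v -> exists z, a = a ** a ** z.
Proof.
move=> def_a; have [n idem] := idempotent_spow (a ** v).
have [w def_aw] : exists w, a = w ** a ** spow (a ** v) n.
  elim: {idem} n => [|n [w IHn]]; first by exists u; rewrite /= {1}def_a !opA.
  by exists (u ** w); rewrite spowSr opA -(opA u) -(opA u) -IHn {1}def_a !opA.
have [z def_z] : exists z, spow (a ** v) n = a ** z.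
  case: n {idem def_aw} => [|n]; first by exists v.
  by exists (v ** spow (a ** v) n); rewrite spowS opA.
by exists z; rewrite -opA -def_z {2}def_aw -opA idem -def_aw.
Qed.

(** An idempotent power of [q] still has a left inverse, so it equals [e]; removing one factor [q]
    from it leaves [p]. *)
Lemma monoid_inverse_sym e p q :
  p ** e = p -> e ** q = q -> p ** q = e -> q ** p = e.
Proof.
move=> pe eq pq.
have e_spow n : e ** spow q n = spow q n by case: n => [|n] //=; rewrite opA eq.
have [n idem] := idempotent_spow q.
have [r r_inv] : exists r, r ** spow q n = e.
  elim: {idem} n => [|n [r IHn]]; first by exists p.
  by exists (r ** p); rewrite spowS opA -(opA r) pq -opA e_spow.
have spow_e : spow q n = e.
  by rewrite -(e_spow n) -r_inv -opA idem.
(* For exponent 1 no factor is left after the removal; then [q = e], hence [p = e]. *)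
case: n spow_e {idem r_inv} => [/= q_e|n qne]; first last.
  have <- : spow q n = p by rewrite -[p]pe -qne spowS opA pq e_spow.
  by rewrite -spowS.
have p_e : p = e by rewrite -pq q_e pe.
by move: pe; rewrite q_e p_e.
Qed.

(** For [e] idempotent, this is the group of units of [eHe]: the equations [e g = g = g e] express
    membership in [eHe]. *)
Definition local_units e : {set H} :=
  [set g | [exists h, [&& e ** g == g, g ** e == g, e ** h == h, h ** e == h,
                          g ** h == e & h ** g == e]]].

Lemma local_unitsP e g : reflect
  (exists h, [/\ e ** g = g, g ** e = g, e ** h = h, h ** e = h &
                 g ** h = e /\ h ** g = e]) (g \in local_units e).
Proof.
rewrite inE; apply: (iffP existsP) => -[h].
  by case/and5P=> /eqP ? /eqP ? /eqP ? /eqP ? /andP[/eqP ? /eqP ?]; exists h.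
by case=> eg ge eh he [gh hg]; exists h; rewrite eg ge eh he gh hg !eqxx.
Qed.

Lemma local_units_mul e : {in local_units e &, forall x y, x ** y \in local_units e}.
Proof.
move=> x y /local_unitsP[x' [ex xe ex' x'e [xx' x'x]]].
move=> /local_unitsP[y' [ey ye ey' y'e [yy' y'y]]].
apply/local_unitsP; exists (y' ** x'); split.
- by rewrite opA ex.
- by rewrite -opA ye.
- by rewrite opA ey'.
- by rewrite -opA x'e.
- by rewrite -opA (opA y) yy' ex' xx' -opA (opA x') x'x ey y'y.
Qed.

Lemma local_units_group e : e ** e = e ->
  exists op' : {x | x \in local_units e} -> {x | x \in local_units e} ->
               {x | x \in local_units e},
    finite_group op' /\ forall x y, val (op' x y) = val x ** val y.
Proof.
move=> idem; pose op' (x y : {x | x \in local_units e}) :=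
  exist (fun x => x \in local_units e) _ (local_units_mul (valP x) (valP y)).
exists op'; split=> //; split=> [x y z|]; first by apply: val_inj; rewrite /= opA.
have Ge : e \in local_units e by apply/local_unitsP; exists e.
exists (exist _ e Ge); split=> [x|x|x]; try apply: val_inj => /=.
- by case/local_unitsP: (valP x) => x' [].
- by case/local_unitsP: (valP x) => x' [].
have /local_unitsP[x' [ex xe ex' x'e [xx' x'x]]] := valP x.
have Gx' : x' \in local_units e by apply/local_unitsP; exists (val x).
by exists (exist _ x' Gx'); split; apply: val_inj.
Qed.

(** Compressing [u] and [v] to [e u e] and [e v e] moves the equation into the monoid [eHe], where
    finiteness makes one-sided inverses two-sided. *)
Lemma mem_local_units e c u v :
  e ** e = e -> e ** c = c -> c ** e = c -> e = u ** c ** v -> c \in local_units e.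
Proof.
move=> idem ec ce def_e; pose p := e ** u ** e; pose q := e ** v ** e.
have ep : e ** p = p by rewrite !opA idem.
have pe : p ** e = p by rewrite -[LHS]opA idem.
have eq : e ** q = q by rewrite !opA idem.
have qe : q ** e = q by rewrite -[LHS]opA idem.
have pcq : p ** c ** q = e.
  rewrite /p /q -(opA _ e c) ec !opA -(opA _ c e) ce -(opA e u c) -(opA e) -def_e.
  by rewrite !idem.
have cqp : c ** q ** p = e.
  apply: (monoid_inverse_sym pe); last by rewrite opA.
  by rewrite opA ec.
have qpc : q ** p ** c = e.
  apply: (monoid_inverse_sym ce); last by rewrite opA.
  by rewrite opA eq.
apply/local_unitsP; exists (q ** p); split=> //.
- by rewrite opA eq.
- by rewrite -opA pe.
- by rewrite opA.
Qed.
End FiniteSemigroup.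

(** By [split_right] and its mirror image, [a] lies in [f H] and in [H f] for every power [f] of
    [a]; an idempotent [f] therefore fixes [a] on both sides. *)
Lemma regular_local_identity (H : finType) (op : H -> H -> H) (a u v : H) :
  associative op -> a = op (op u (op a a)) v ->
  exists n, let e := iter n (op a) a in [/\ op e e = e, op e a = a & op a e = a].
Proof.
move=> opA def_a.
have opA' : associative (fun x y => op y x) by move=> x y z /=; rewrite opA.
have [z def_az] := split_right opA def_a.
have [z' def_za] : exists z', a = op z' (op a a).
  by apply: (split_right opA' (u := v) (v := u)); rewrite /= opA.
have factor_l n : exists w, a = op (iter n (op a) a) w.
  elim: n => [|n [w IHn]]; first by exists (op a z); rewrite /= opA.
  by exists (op w z); rewrite iterS -opA (opA _ w) -IHn opA.
have factor_r n : exists w, a = op w (iter n (op a) a).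
  elim: n => [|n [w IHn]]; first by exists (op z' a); rewrite /= -opA.
  by exists (op z' w); rewrite spowSr // opA -(opA z') -IHn -opA.
have [n idem] := idempotent_spow opA a; exists n.
have [w] := factor_l n; have [w'] := factor_r n.
move: (iter n (op a) a) idem => e idem def_ar def_al; split=> //.
- by rewrite {1}def_al opA idem -def_al.
- by rewrite {1}def_ar -opA idem -def_ar.
Qed.

Lemma minimal_ideal (H : finType) (op : H -> H -> H) (P : {pred H}) (x0 : H) :
  associative op -> P x0 ->
  exists I : {set H},
    [/\ forall x s, x \in I -> op s x \in I /\ op x s \in I,
        exists2 a, a \in I & P a
      & forall a b s t, a \in I -> b \in I -> P (op (op s b) t) ->
          exists s' t', a = op (op s' b) t'].
Proof.
move=> opA Px0.
pose ideal (I : {set H}) :=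
  [forall x in I, forall s, (op s x \in I) && (op x s \in I)].
pose good I := ideal I && [exists a in I, P a].
have [I minI _] : {I | minset good I & I \subset [set: H]}.
  apply: minset_exists; apply/andP; split.
    by apply/forall_inP => x _; apply/forallP => s; rewrite !inE.
  by apply/exists_inP; exists x0; rewrite ?inE.
have [/andP[/forall_inP idI /exists_inP[a0 Ia0 Pa0]] minI'] := minsetP minI.
have absorb x s : x \in I -> op s x \in I /\ op x s \in I.
  by move=> /idI /forallP /(_ s) /andP.
exists I; split=> //; first by exists a0.
move=> a b s t Ia Ib Psbt.
(* [J = HbH] is an ideal inside [I] that meets [P] in [s b t], so minimality forces [J = I]. *)
pose J := [set op (op p.1 b) p.2 | p : H * H].
suff JI : J = I.
  by move: Ia; rewrite -JI => /imsetP[[s' t'] _ ->]; exists s', t'.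
apply: minI'; last first.
  apply/fintype.subsetP => _ /imsetP[[s' t'] _ ->] /=.
  by apply: (absorb _ _ _).2; apply: (absorb _ _ _).1.
apply/andP; split; last first.
  by apply/exists_inP; exists (op (op s b) t) => //; apply/imsetP; exists (s, t).
apply/forall_inP => _ /imsetP[[s' t'] _ ->]; apply/forallP => r.
apply/andP; split; apply/imsetP.
  by exists (op r s', t'); rewrite //= !opA.
by exists (s', op t' r); rewrite //= !opA.
Qed.

Local Open Scope classical_set_scope.

(** * Powers of compact sets and of small neighbourhoods *)

Section TopologicalGroup.
Variables (T : topologicalType) (mul : T -> T -> T) (inv : T -> T) (e : T).
Hypothesis G : topological_group mul inv e.
Local Notation "x ** y" := (mul x y) (at level 40, left associativity).

Let mulgA : associative mul. Proof. by have [[]] := G. Qed.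
Let mul1g : left_id e mul. Proof. by have [[]] := G. Qed.
Let mulg1 : right_id e mul. Proof. by have [[]] := G. Qed.
Let mulVg x : inv x ** x = e. Proof. by have [[]] := G. Qed.
Let mulgV x : x ** inv x = e. Proof. by have [[]] := G. Qed.
Let mulKg x y : inv x ** (x ** y) = y. Proof. by rewrite mulgA mulVg mul1g. Qed.
Let mulgK x y : x ** y ** inv y = x. Proof. by rewrite -mulgA mulgV mulg1. Qed.
Let inv_unique x y : x ** y = e -> inv x = y.
Proof. by move=> xy; rewrite -[LHS]mulg1 -xy mulKg. Qed.
Let invgK x : inv (inv x) = x. Proof. exact: inv_unique. Qed.
Let invgM x y : inv (x ** y) = inv y ** inv x.
Proof. by apply: inv_unique; rewrite mulgA mulgK. Qed.
Let invg1 : inv e = e. Proof. exact: inv_unique. Qed.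

Fixpoint setpow (A : set T) n : set T :=
  if n is m.+1 then (fun p : T * T => p.1 ** p.2) @` (A `*` setpow A m) else [set e].

Lemma setpow_mul A m n x y : setpow A m x -> setpow A n y -> setpow A (m + n) (x ** y).
Proof.
elim: m x => [|m IHm] x; first by move=> -> ; rewrite mul1g.
move=> [[a b] /= [Aa mb] <-] ny; exists (a, b ** y) => /=; last by rewrite mulgA.
by split=> //; apply: IHm.
Qed.

Lemma setpow1 A x : A x -> setpow A 1 x.
Proof. by move=> Ax; exists (x, e) => //=; rewrite mulg1. Qed.

Lemma setpow_inv A n x :
  (forall x, A x -> A (inv x)) -> setpow A n x -> setpow A n (inv x).
Proof.
move=> symA; elim: n x => [|n IHn] x; first by move=> ->; rewrite /= invg1.
move=> [[a b] /= [Aa nb] <-]; rewrite invgM.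
by have := setpow_mul (IHn _ nb) (setpow1 (symA _ Aa)); rewrite addn1.
Qed.

Lemma setpow_mono A m n : A e -> (m <= n)%N -> setpow A m `<=` setpow A n.
Proof.
move=> Ae /subnK <-; elim: (n - m)%N => [|k IHk] x mx //.
by exists (e, x) => /=; rewrite ?mul1g //; split=> //; exact: IHk.
Qed.

Lemma setpow_sub A B n : A `<=` B -> setpow A n `<=` setpow B n.
Proof.
move=> AB; elim: n => [|n IHn] x //= [[a b] /= [Aa nb] <-].
by exists (a, b) => //; split; [exact: AB | exact: IHn].
Qed.

Lemma compact_setpow A n : compact A -> compact (setpow A n).
Proof.
move=> cA; elim: n => [|n IHn] /=; first exact: compact_set1.
apply: continuous_compact; last exact: compact_setX.
by apply: continuous_subspaceT; case: G.
Qed.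

(** Continuity of multiplication at [(e, e)] puts some [A B] inside [N]; the induction takes [V]
    inside [A] with [V^n] inside [B]. *)
Lemma nbhs_small_powers N n : nbhs e N -> exists V,
  [/\ nbhs e V, forall x, V x -> V (inv x) & setpow V n `<=` N].
Proof.
have [_ mulC invC] := G.
have symmetrize A : nbhs e A -> nbhs e (A `&` inv @^-1` A).
  by move=> eA; apply: filterI => //; apply: invC; rewrite invg1.
elim: n N => [|n IHn] N eN.
  exists (setT `&` inv @^-1` setT); split=> //; first by apply: symmetrize; exact: filterT.
  by move=> _ ->; exact: nbhs_singleton.
have [[A B] /= [eA eB] ABN] : nbhs (e, e) ((fun p : T * T => p.1 ** p.2) @^-1` N).
  by apply: mulC; rewrite /= mul1g.
have [V [eV symV VB]] := IHn B eB.
exists (V `&` (A `&` inv @^-1` A)); split.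
- by apply: filterI => //; exact: symmetrize.
- by move=> x [Vx [Ax Aix]]; split; [exact: symV | split=> //=; rewrite invgK].
- move=> _ [[a b] /= [[Va [Aa _]] nb] <-]; apply: (ABN (a, b)); split=> //=.
  by apply: VB; apply: setpow_sub nb => x [].
Qed.

(** * From semigroup approximations to group approximations *)

Lemma approximable_finite_group_of_semigroup : locally_compact [set: T] ->
  approximable_by mul e finite_semigroup -> approximable_by mul e finite_group.
Proof.
move=> lcT approx C U cC eU.
have [K eK [cK _]] : compact_near (nbhs e).
  by have := lcT e I; rewrite withinET.
pose Q := (K `|` C) `|` inv @` (K `|` C).
have cQ : compact Q.
  have cKC : compact (K `|` C) by exact: compactU.
  apply: compactU => //; apply: continuous_compact => //.
  by apply: continuous_subspaceT; case: G.
have symQ x : Q x -> Q (inv x).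
  by case=> [Kx|[y Ky <-]]; [right; exists x | left; rewrite invgK].
have KQ : K `<=` Q by move=> x Kx; left; left.
have CQ : C `<=` Q by move=> x Cx; left; right.
have Qe : Q e by exact: (KQ _ (nbhs_singleton eK)).
(* The final error [w] is a product of 7 elements of [V], so exponent 8 suffices. *)
have [V [eV symV VKU]] := nbhs_small_powers 8 (filterI eK eU).
have Ve : V e by exact: nbhs_singleton.
have Vpow m : (m <= 8)%N -> setpow V m `<=` K `&` U.
  by move=> le_m8 x Vx; apply: VKU; apply: setpow_mono Vx.
have VQ m x : (m <= 8)%N -> setpow V m x -> setpow Q 1 x.
  by move=> le_m8 /(Vpow _ le_m8)[/KQ Qx _]; exact: setpow1.
(* The longest product formed below is [s (a x a) t]: [j (a x a)] is a product
   of 8 elements of [Q], and [s], [t] and the errors account for 3 more. *)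
have [H [op [j [opA inj_j [cover almost]]]]] := approx _ _ (compact_setpow (n := 11) cQ) eV.
have Qle m x : (m <= 11)%N -> setpow Q m x -> setpow Q 11 x.
  by move=> le_m; exact: setpow_mono.
(* In [lift] and [prod] the error costs one more factor of [Q], since [V] is inside [Q]. *)
have lift m g : (m <= 11)%N -> setpow Q m g ->
    exists h v, [/\ V v, j h = g ** v & setpow Q m.+1 (j h)].
  move=> le_m Qg; have [h _ [v Vv def_g]] := cover _ (Qle _ _ le_m Qg).
  have jh : j h = g ** inv v by rewrite -def_g mulgK.
  exists h, (inv v); split=> //; first exact: symV.
  rewrite jh -addn1; apply: setpow_mul => //.
  by apply: (VQ 1) => //; apply: setpow1; exact: symV.
have prod m n k x y : (m <= 11)%N -> (n <= 11)%N -> (k <= 11)%N ->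
    setpow Q m (j x) -> setpow Q n (j y) -> setpow Q k (j x ** j y) ->
    exists v, [/\ V v, j (op x y) = j x ** j y ** v & setpow Q k.+1 (j (op x y))].
  move=> le_m le_n le_k Qx Qy Qxy.
  have [|||v Vv jxy] := almost x y; [exact: Qle Qx|exact: Qle Qy|exact: Qle Qxy|].
  exists v; split=> //; rewrite jxy -addn1; apply: setpow_mul => //.
  by apply: (VQ 1) => //; exact: setpow1.
(* With [j s] small and [j t] close to the inverse of [j (s b)], only two errors remain in
   [j (s b t)]. *)
have recover m b : (m <= 8)%N -> setpow Q m (j b) ->
    exists s t, setpow V 2 (j (op (op s b) t)).
  move=> le_m Qb.
  have [s [v1 [Vv1 js _]]] := lift 0 e isT erefl.
  have Qs : setpow Q 1 (j s) by rewrite js mul1g; apply: (VQ 1) => //; exact: setpow1.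
  have [|||v2 [_ _ Qsb]] := prod 1 m m.+1 s b _ _ _ Qs Qb (setpow_mul Qs Qb); try lia.
  have [|t [v3 [Vv3 jt Qt]]] := lift m.+2 (inv (j (op s b))) _ (setpow_inv symQ Qsb).
    lia.
  have jsbt : j (op s b) ** j t = v3 by rewrite jt mulgA mulgV mul1g.
  exists s, t; have [||||v4 [Vv4 -> _]] := prod m.+2 m.+3 1 (op s b) t _ _ _ Qsb Qt; try lia.
    by rewrite jsbt; apply: (VQ 1) => //; exact: setpow1.
  by rewrite jsbt; apply: (@setpow_mul _ 1 1); exact: setpow1.
pose P : {pred H} := fun h => `[< K (j h) >].
have [x0 Px0] : exists x0, P x0.
  have [h [v [Vv jh _]]] := lift 0 e isT erefl; exists h; apply/asboolP.
  by rewrite jh mul1g; apply: (Vpow 1 _ _ _).1 => //; exact: setpow1.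
have [I [absorb [a0 Ia0 /asboolP Ka0] minI]] := minimal_ideal opA Px0.
have [a Ia Va] : exists2 a, a \in I & setpow V 2 (j a).
  have [s [t Vsat]] := recover 1 a0 isT (setpow1 (KQ _ Ka0)).
  by exists (op (op s a0) t) => //; apply: (absorb _ _ _).2; apply: (absorb _ _ _).1.
have Qa : setpow Q 1 (j a) by exact: VQ Va.
(* Since [V^2] is inside [K], every controlled [b] in [I] generates [I]. *)
have generate m b c : (m <= 8)%N -> setpow Q m (j b) -> b \in I -> c \in I ->
    exists s t, c = op (op s b) t.
  move=> le_m Qb Ib Ic; have [s [t Vsbt]] := recover m b le_m Qb.
  by apply: (minI c b s t) => //; apply/asboolP; exact: (Vpow 2 _ _ Vsbt).1.
have Iaa : op a a \in I by exact: (absorb a a Ia).1.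
have [u [v def_a]] : exists u v, a = op (op u (op a a)) v.
  have [|||w [_ _ Qaa]] := prod 1 1 2 a a _ _ _ Qa Qa (setpow_mul Qa Qa) => //.
  exact: (generate 3).
have [n] := regular_local_identity opA def_a.
have : iter n (op a) a \in I by elim: n => //= n IHn; exact: (absorb _ a IHn).1.
move: (iter n _ a) => i Ii [idem ia ai].
have [op' [grp valM]] := local_units_group opA idem.
exists _, op', (j \o val); split=> //; first exact: inj_comp inj_j val_inj.
split=> [c Cc|x y Cx Cy Cxy]; last first.
  (* Multiplicativity is inherited from [j], as [C] is inside [Q] and [V] inside [U]. *)
  rewrite /= valM; have [|||w Vw ->] := almost (val x) (val y);
    try by apply: (Qle 1) => //; exact/setpow1/CQ.
  by exists w => //; apply: (Vpow 1 _ _ _).2 => //; exact: setpow1.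
have Va' : setpow V 2 (inv (j a)) by exact: setpow_inv.
have Qa' : setpow Q 1 (inv (j a)) by exact: VQ Va'.
have Qc : setpow Q 1 c by exact/setpow1/CQ.
(* Choosing [j x] near [(j a)^-1 c (j a)^-1] makes [j (a x a)] close to [c]
   without conjugating a small element by [c]. *)
have [x [v1 [Vv1 jx Qx]]] :=
  lift 3 _ isT (setpow_mul (setpow_mul Qa' Qc) Qa').
have [|||v2 [Vv2 jax Qax]] := prod 1 4 5 a x _ _ _ Qa Qx (setpow_mul Qa Qx) => //.
have [|||v3 [Vv3 jaxa Qaxa]] :=
  prod 6 1 7 (op a x) a _ _ _ Qax Qa (setpow_mul Qax Qa) => //.
have Iaxa : op (op a x) a \in I by exact: (absorb a (op a x) Ia).1.
(* As a power of [a], [i] lies in [I], so [i = s (a x a) t]; this makes [a x a] invertible in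
   [iHi]. *)
have [s [t def_i]] := generate 8 _ _ isT Qaxa Iaxa Ii.
have Gaxa : op (op a x) a \in local_units op i.
  by apply: (mem_local_units opA idem _ _ def_i); [rewrite !opA ia | rewrite -opA ai].
exists (exist (fun x => x \in local_units op i) _ Gaxa) => //.
pose w := inv (j a) ** v1 ** v2 ** j a ** v3.
have jw : j (op (op a x) a) = c ** w.
  by rewrite jaxa jax jx /w !mulgA mulgV mul1g.
(* Covering asks for [c = j (a x a) u], so [u] is the inverse of the error. *)
exists (inv w); last by rewrite /= jw mulgK.
apply: (Vpow 7 _ _ _).2 => //; apply: setpow_inv => //.
have pV y : V y -> setpow V 1 y by exact: setpow1.
(* Factor count for [w]: 2 + 1 + 1 + 2 + 1 = 7. *)
have Vvv := setpow_mul (setpow_mul Va' (pV _ Vv1)) (pV _ Vv2).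
exact: setpow_mul (setpow_mul Vvv Va) (pV _ Vv3).
Qed.
End TopologicalGroup.

Theorem theorem3 (T : topologicalType) (mul : T -> T -> T) (inv : T -> T) (e : T) :
  locally_compact_group mul inv e ->
  (approximable_by mul e finite_semigroup <-> approximable_by mul e finite_group).
Proof.
move=> [G _ lcT]; split; first exact: (approximable_finite_group_of_semigroup G lcT).
move=> approx C U cC eU; have [H [op [j [[opA _] inj_j CU]]]] := approx C U cC eU.
by exists H, op, j; split.
Qed.
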